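(* (Existence of solutions.) Every well-nested $G$-coalgebra admits a solution.
   Context: Syntax. Fix disjoint nonempty sets $\Sigma$ (actions) and $T=\{t_1,\dots,t_n\}$ (primitive tests), $T$ finite. Boolean expressions $b,c\in\mathrm{BExp}$ are generated by $0 \mid 1 \mid t\in T \mid b\cdot c \mid b+c \mid \overline{b}$. GKAT expressions $e,f,g\in\mathrm{Exp}$ are generated by $p\in\Sigma \mid b\in\mathrm{BExp} \mid e\cdot f \mid e+_b f \mid e^{(b)}$; $ef$ abbreviates $e\cdot f$. $\equiv_{BA}$ denotes Boolean equivalence, $b\le c$ iff $b+c\equiv_{BA}c$. $\mathrm{At}$ is the finite set of atoms (minimal nonzero elements) of the free Boolean algebra $\mathrm{BExp}/{\equiv_{BA}}$ on $T$; an atom is also used as a Boolean expression via a representative $c_1\cdots c_n$ with $c_i\in\{t_i,\overline{t_i}\}$. Axioms. $E:\mathrm{Exp}\to\mathrm{BExp}$ is defined by $E(b)=b$, $E(p)=0$, $E(e+_bf)=b\cdot E(e)+\overline{b}\cdot E(f)$, $E(e\cdot f)=E(e)\cdot E(f)$, $E(e^{(b)})=\overline{b}$. The relation $\equiv$ is the smallest congruence (with respect to all operators) on $\mathrm{Exp}$ such that $b\equiv_{BA}c$ implies $b\equiv c$ and, for all $e,f,g\in\mathrm{Exp}$, $b,c\in\mathrm{BExp}$: (U1) $e+_be\equiv e$; (U2) $e+_bf\equiv f+_{\overline{b}}e$; (U3) $(e+_bf)+_cg\equiv e+_{bc}(f+_cg)$; (U4) $e+_bf\equiv be+_bf$; (U5)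 $eg+_bfg\equiv(e+_bf)\cdot g$; (S1) $(e\cdot f)\cdot g\equiv e\cdot(f\cdot g)$; (S2) $0\cdot e\equiv0$; (S3) $e\cdot0\equiv0$; (S4) $1\cdot e\equiv e$; (S5) $e\cdot1\equiv e$; (W1) $e^{(b)}\equiv ee^{(b)}+_b1$; (W2) $(e+_c1)^{(b)}\equiv(ce)^{(b)}$; (W3) if $g\equiv eg+_bf$ and $E(e)\equiv0$, then $g\equiv e^{(b)}f$. Guarded sums. For $\Phi\subseteq\mathrm{At}$ and expressions $(e_\alpha)_{\alpha\in\Phi}$: $\bigoplus_{\alpha\in\emptyset}e_\alpha=0$ and, for any choice of $\beta\in\Phi$, $\bigoplus_{\alpha\in\Phi}e_\alpha=e_\beta+_\beta\bigl(\bigoplus_{\alpha\in\Phi\setminus\{\beta\}}e_\alpha\bigr)$ (the choice of $\beta$ is immaterial up to $\equiv$). Coalgebras. Let $GX=(2+\Sigma\times X)^{\mathrm{At}}$ with $2=\{0,1\}$. A $G$-coalgebra is a pair $\mathcal{X}=\langle X,\delta^{\mathcal{X}}\rangle$ with $\delta^{\mathcal{X}}:X\to GX$. The coproduct $\mathcal{X}+\mathcal{Y}$ has the disjoint union $X+Y$ as states, with $\delta^{\mathcal{X}}$ on $X$ and $\delta^{\mathcal{Y}}$ on $Y$. For $Y\subseteq X$ and $h\in GX$, the uniform continuation $\mathcal{X}[Y,h]=\langle X,\delta[Y,h]\rangle$ is given by $\delta[Y,h](x)(\alpha)=h(\alpha)$ if $x\in Y$ and $\delta^{\mathcal{X}}(x)(\alpha)=1$,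 and $\delta^{\mathcal{X}}(x)(\alpha)$ otherwise. Well-nested coalgebras are defined inductively: (i) if $\mathcal{X}$ has no transitions, i.e. $\delta^{\mathcal{X}}(x)(\alpha)\in2$ for all $x,\alpha$, then $\mathcal{X}$ is well-nested; (ii) if $\mathcal{X}$ and $\mathcal{Y}$ are well-nested and $h\in G(X+Y)$, then $(\mathcal{X}+\mathcal{Y})[X,h]$ is well-nested. Solutions. A map $s:X\to\mathrm{Exp}$ is a solution to $\mathcal{X}$ if for all $x\in X$, $s(x)\equiv\bigoplus_{\alpha\in\mathrm{At}}\lfloor\delta^{\mathcal{X}}(x)(\alpha)\rfloor_s$, where $\lfloor0\rfloor_s=0$, $\lfloor1\rfloor_s=1$, $\lfloor(p,x')\rfloor_s=p\cdot s(x')$. *)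

(* Defs.v *)
From mathcomp Require Import all_boot.
From Stdlib Require Import Setoid Morphisms.

Set Implicit Arguments.
Unset Strict Implicit.
Unset Printing Implicit Defensive.

Reserved Notation "b ≡BA c" (at level 70, no associativity).
Reserved Notation "b ≤BA c" (at level 70, no associativity).
Reserved Notation "e ≡ f" (at level 70, no associativity).
Reserved Notation "e ⋅ f" (at level 40, left associativity).
Reserved Notation "e +_[ b ] f" (at level 50, left associativity,
  format "e  +_[ b ]  f").
Reserved Notation "e ^[ b ]" (at level 1, left associativity,
  format "e ^[ b ]").

Inductive bexp (T : Type) : Type :=
| BZero
| BOne
| BPrim of T
| BAnd of bexp T & bexp T
| BOr of bexp T & bexp T
| BNeg of bexp T.

Arguments BZero {T}.
Arguments BOne {T}.

Inductive ba_eq (T : Type) : bexp T -> bexp T -> Prop :=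
| ba_refl b : b ≡BA b
| ba_sym b c : b ≡BA c -> c ≡BA b
| ba_trans b c d : b ≡BA c -> c ≡BA d -> b ≡BA d
| ba_and_congr b b' c c' : b ≡BA b' -> c ≡BA c' -> BAnd b c ≡BA BAnd b' c'
| ba_or_congr b b' c c' : b ≡BA b' -> c ≡BA c' -> BOr b c ≡BA BOr b' c'
| ba_neg_congr b b' : b ≡BA b' -> BNeg b ≡BA BNeg b'
| ba_andA b c d : BAnd b (BAnd c d) ≡BA BAnd (BAnd b c) d
| ba_orA b c d : BOr b (BOr c d) ≡BA BOr (BOr b c) d
| ba_andC b c : BAnd b c ≡BA BAnd c b
| ba_orC b c : BOr b c ≡BA BOr c b
| ba_and_orr b c d : BAnd b (BOr c d) ≡BA BOr (BAnd b c) (BAnd b d)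
| ba_or_andr b c d : BOr b (BAnd c d) ≡BA BAnd (BOr b c) (BOr b d)
| ba_and1 b : BAnd b BOne ≡BA b
| ba_or0 b : BOr b BZero ≡BA b
| ba_andN b : BAnd b (BNeg b) ≡BA BZero
| ba_orN b : BOr b (BNeg b) ≡BA BOne
where "b ≡BA c" := (ba_eq b c).

Definition ba_le (T : Type) (b c : bexp T) : Prop := BOr b c ≡BA c.
Notation "b ≤BA c" := (ba_le b c).

(** An atom [c_1 ... c_n], with each [c_i] either [t_i] or its complement, is
    encoded by the truth assignment recording which literals are positive;
    [atomP] below shows that these are exactly the minimal nonzero elements of
    the free Boolean algebra. *)
Notation atom T := {ffun T -> bool}.

Definition literal (T : finType) (a : atom T) (t : T) : bexp T :=
  if a t then BPrim t else BNeg (BPrim t).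

Definition atom_bexp (T : finType) (a : atom T) : bexp T :=
  foldr (fun t b => BAnd (literal a t) b) BOne (enum T).

Definition ba_minimal_nonzero (T : Type) (b : bexp T) : Prop :=
  ~ b ≡BA BZero /\ forall c, c ≤BA b -> c ≡BA BZero \/ c ≡BA b.

Inductive exp (Sigma T : Type) : Type :=
| EAct of Sigma
| ETest of bexp T
| ESeq of exp Sigma T & exp Sigma T
| EIf of bexp T & exp Sigma T & exp Sigma T
| EWhile of bexp T & exp Sigma T.

Arguments EAct {Sigma T}.
Arguments ETest {Sigma T}.

Notation "e ⋅ f" := (ESeq e f).
Notation "e +_[ b ] f" := (EIf b e f).
Notation "e ^[ b ]" := (EWhile b e).

Fixpoint E (Sigma T : Type) (e : exp Sigma T) : bexp T :=
  match e with
  | EAct _ => BZero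
  | ETest b => b
  | e ⋅ f => BAnd (E e) (E f)
  | e +_[b] f => BOr (BAnd b (E e)) (BAnd (BNeg b) (E f))
  | _ ^[b] => BNeg b
  end.

(** For Boolean [b] and [c], the expression written [b ⋅ c] on paper is at the
    same time a Boolean conjunction and a sequential composition.  The syntax
    trees [ETest (BAnd b c)] and [ETest b ⋅ ETest c] are distinct here, so
    [gkat_test_and] identifies them.  It does not follow from the other rules:
    without it, not even [ETest b ⋅ ETest (BNeg b) ≡ ETest BZero] is derivable
    when [b] is a primitive test. *)
Inductive gkat_eq (Sigma T : Type) : exp Sigma T -> exp Sigma T -> Prop :=
| gkat_refl e : e ≡ e
| gkat_sym e f : e ≡ f -> f ≡ e
| gkat_trans e f g : e ≡ f -> f ≡ g -> e ≡ g
| gkat_seq_congr e e' f f' : e ≡ e' -> f ≡ f' -> e ⋅ f ≡ e' ⋅ f'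
| gkat_if_congr b b' e e' f f' :
    ETest b ≡ ETest b' -> e ≡ e' -> f ≡ f' -> e +_[b] f ≡ e' +_[b'] f'
| gkat_while_congr b b' e e' :
    ETest b ≡ ETest b' -> e ≡ e' -> e ^[b] ≡ e' ^[b']
| gkat_ba b c : b ≡BA c -> ETest b ≡ ETest c
| gkat_test_and b c : ETest b ⋅ ETest c ≡ ETest (BAnd b c)
| gkat_U1 b e : e +_[b] e ≡ e
| gkat_U2 b e f : e +_[b] f ≡ f +_[BNeg b] e
| gkat_U3 b c e f g : (e +_[b] f) +_[c] g ≡ e +_[BAnd b c] (f +_[c] g)
| gkat_U4 b e f : e +_[b] f ≡ (ETest b ⋅ e) +_[b] f
| gkat_U5 b e f g : (e ⋅ g) +_[b] (f ⋅ g) ≡ (e +_[b] f) ⋅ g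
| gkat_S1 e f g : (e ⋅ f) ⋅ g ≡ e ⋅ (f ⋅ g)
| gkat_S2 e : ETest BZero ⋅ e ≡ ETest BZero
| gkat_S3 e : e ⋅ ETest BZero ≡ ETest BZero
| gkat_S4 e : ETest BOne ⋅ e ≡ e
| gkat_S5 e : e ⋅ ETest BOne ≡ e
| gkat_W1 b e : e ^[b] ≡ (e ⋅ e ^[b]) +_[b] ETest BOne
| gkat_W2 b c e : (e +_[c] ETest BOne) ^[b] ≡ (ETest c ⋅ e) ^[b]
| gkat_W3 b e f g :
    g ≡ (e ⋅ g) +_[b] f -> ETest (E e) ≡ ETest BZero -> g ≡ e ^[b] ⋅ f
where "e ≡ f" := (gkat_eq e f).

(** The order in which the atoms are peeled off is immaterial up to [≡]; the
    order of [enum Phi] is used. *)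
Definition gsum (Sigma : Type) (T : finType) (Phi : {set atom T})
    (e : atom T -> exp Sigma T) : exp Sigma T :=
  foldr (fun a f => e a +_[atom_bexp a] f) (ETest BZero) (enum Phi).

(** In [bool + Sigma * X], [inl false] is rejection and [inl true] acceptance. *)
Definition G (Sigma : Type) (T : finType) (X : Type) : Type :=
  atom T -> bool + Sigma * X.

Record coalgebra (Sigma : Type) (T : finType) : Type := Coalgebra {
  state :> Type;
  delta : state -> G Sigma T state
}.

Definition map_outcome (Sigma X Y : Type) (f : X -> Y)
    (o : bool + Sigma * X) : bool + Sigma * Y :=
  match o with
  | inl r => inl r
  | inr (p, x) => inr (p, f x)
  end.

Definition coproduct (Sigma : Type) (T : finType) (X Y : coalgebra Sigma T) :
    coalgebra Sigma T :=
  @Coalgebra Sigma T (X + Y)%type (fun z a =>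
    match z with
    | inl x => map_outcome inl (delta x a)
    | inr y => map_outcome inr (delta y a)
    end).

Definition uniform_continuation (Sigma : Type) (T : finType)
    (X : coalgebra Sigma T) (Y : pred X) (h : G Sigma T X) :
    coalgebra Sigma T :=
  @Coalgebra Sigma T X (fun x a =>
    match delta x a with
    | inl true => if Y x then h a else inl true
    | o => o
    end).

Definition in_left (X Y : Type) : pred (X + Y) :=
  fun z => if z is inl _ then true else false.

Inductive well_nested (Sigma : Type) (T : finType) :
    coalgebra Sigma T -> Prop :=
| well_nested_base (X : coalgebra Sigma T) :
    (forall (x : X) (a : atom T), exists r : bool, delta x a = inl r) ->
    well_nested X
| well_nested_step (X Y : coalgebra Sigma T)
    (h : G Sigma T (coproduct X Y)) :
    well_nested X -> well_nested Y ->
    well_nested (@uniform_continuation Sigma T (coproduct X Y)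
                   (@in_left X Y) h).

Definition outcome_exp (Sigma T X : Type) (s : X -> exp Sigma T)
    (o : bool + Sigma * X) : exp Sigma T :=
  match o with
  | inl false => ETest BZero
  | inl true => ETest BOne
  | inr (p, x) => EAct p ⋅ s x
  end.

Definition is_solution (Sigma : Type) (T : finType) (X : coalgebra Sigma T)
    (s : X -> exp Sigma T) : Prop :=
  forall x : X, s x ≡ gsum [set: atom T] (fun a => outcome_exp s (delta x a)).

#[local] Hint Resolve ba_refl : core.

#[export] Instance ba_eq_equiv (T : Type) : Equivalence (@ba_eq T).
Proof. by split; [exact: ba_refl | exact: ba_sym | exact: ba_trans]. Qed.

#[export] Instance BAnd_proper (T : Type) :
  Proper (@ba_eq T ==> @ba_eq T ==> @ba_eq T) (@BAnd T).
Proof. by move=> b b' Hb c c' Hc; apply: ba_and_congr. Qed.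

#[export] Instance BOr_proper (T : Type) :
  Proper (@ba_eq T ==> @ba_eq T ==> @ba_eq T) (@BOr T).
Proof. by move=> b b' Hb c c' Hc; apply: ba_or_congr. Qed.

#[export] Instance BNeg_proper (T : Type) :
  Proper (@ba_eq T ==> @ba_eq T) (@BNeg T).
Proof. by move=> b b' Hb; apply: ba_neg_congr. Qed.

Fixpoint beval (T : Type) (v : T -> bool) (b : bexp T) : bool :=
  match b with
  | BZero => false
  | BOne => true
  | BPrim t => v t
  | BAnd b c => beval v b && beval v c
  | BOr b c => beval v b || beval v c
  | BNeg b => ~~ beval v b
  end.

Lemma beval_sound (T : Type) (v : T -> bool) (b c : bexp T) :
  b ≡BA c -> beval v b = beval v c.
Proof.
elim=> /= {b c}; try by move=> *; congruence.
- by move=> b c d; rewrite andbA.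
- by move=> b c d; rewrite orbA.
- by move=> b c; rewrite andbC.
- by move=> b c; rewrite orbC.
- by move=> b c d; rewrite andb_orr.
- by move=> b c d; rewrite orb_andr.
- by move=> b; rewrite andbT.
- by move=> b; rewrite orbF.
- by move=> b; rewrite andbN.
- by move=> b; rewrite orbN.
Qed.

Section BooleanAlgebra.
Variable T : Type.
Implicit Types b c d : bexp T.

Lemma ba_andb b : BAnd b b ≡BA b.
Proof.
by rewrite -{3}[b]ba_and1 -(ba_orN b) ba_and_orr ba_andN ba_or0.
Qed.

Lemma ba_orb b : BOr b b ≡BA b.
Proof.
by rewrite -{3}[b]ba_or0 -(ba_andN b) ba_or_andr ba_orN ba_and1.
Qed.

Lemma ba_and0 b : BAnd b BZero ≡BA BZero.
Proof. by rewrite -(ba_andN b) ba_andA ba_andb. Qed.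

Lemma ba_or1 b : BOr b BOne ≡BA BOne.
Proof. by rewrite -(ba_orN b) ba_orA ba_orb. Qed.

Lemma ba_absorb b c : BAnd b (BOr b c) ≡BA b.
Proof.
rewrite -{1}[b]ba_or0 -ba_or_andr (ba_andC BZero) ba_and0.
exact: ba_or0.
Qed.

Lemma ba_le_and b c : b ≤BA c -> BAnd c b ≡BA b.
Proof. by move=> le_bc; rewrite -le_bc ba_andC ba_absorb. Qed.

Lemma ba_and_le b c : BAnd b c ≡BA b -> b ≤BA c.
Proof.
move=> bc; rewrite /ba_le -bc ba_orC (ba_andC b) -{1}[c]ba_and1 -ba_and_orr.
by rewrite ba_orC ba_or1 ba_and1.
Qed.

Lemma ba_split b c :
  BAnd b c ≡BA BZero -> BAnd (BNeg b) c ≡BA BZero -> c ≡BA BZero.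
Proof.
move=> bc nbc; rewrite -[c]ba_and1 -(ba_orN b) ba_and_orr.
by rewrite (ba_andC c) bc (ba_andC c) nbc ba_or0.
Qed.

End BooleanAlgebra.

Section Atoms.
Variable T : finType.
Implicit Types (a : atom T) (b c : bexp T) (ts : seq T).

Let lits a ts : bexp T := foldr (fun t b => BAnd (literal a t) b) BOne ts.

Lemma lits_literal a ts t :
  t \in ts -> BAnd (lits a ts) (literal a t) ≡BA lits a ts.
Proof.
elim: ts => //= u ts IH; rewrite inE => /predU1P [<-|/IH tts].
  by rewrite ba_andC ba_andA ba_andb.
by rewrite -ba_andA tts.
Qed.

Lemma atom_and a b :
  BAnd (atom_bexp a) b ≡BA if beval a b then atom_bexp a else BZero.
Proof.
elim: b => /= [||t|b IHb c IHc|b IHb c IHc|b IHb].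
- exact: ba_and0.
- exact: ba_and1.
- have : BAnd (atom_bexp a) (literal a t) ≡BA atom_bexp a.
    by apply: lits_literal; rewrite mem_enum.
  rewrite /literal; case: (a t) => // <-.
  by rewrite -ba_andA (ba_andC (BNeg _)) ba_andN ba_and0.
- rewrite ba_andA IHb; case: (beval a b) => //=.
  by rewrite ba_andC ba_and0.
- rewrite ba_and_orr IHb IHc; case: (beval a b); case: (beval a c) => /=.
  + exact: ba_orb.
  + exact: ba_or0.
  + by rewrite ba_orC ba_or0.
  + exact: ba_or0.
- case: (beval a b) IHb => /= IHb.
    by rewrite -IHb -ba_andA ba_andN ba_and0.
  by rewrite -{2}[atom_bexp a]ba_and1 -(ba_orN b) ba_and_orr IHb ba_orC ba_or0.
Qed.

Lemma beval_atom a a' : beval a' (atom_bexp a) = (a' == a).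
Proof.
have -> : beval a' (atom_bexp a) = all (fun t => a' t == a t) (enum T).
  rewrite /atom_bexp; elim: (enum T) => //= t ts ->; congr (_ && _).
  by rewrite /literal; case: (a t) => /=; case: (a' t).
apply/allP/eqP => [eq_a|-> //]; apply/ffunP => t.
by apply/eqP/eq_a; rewrite mem_enum.
Qed.

Lemma beval_complete0 b : (forall a, beval a b = false) -> b ≡BA BZero.
Proof.
move=> b0.
have {b0} : forall a, BAnd (lits a (enum T)) b ≡BA BZero.
  by move=> a; have := atom_and a b; rewrite b0.
elim: (enum T) (enum_uniq T) => /= [_ /(_ [ffun=> true])|t ts IH].
  by rewrite ba_andC ba_and1.
case/andP=> tts uts b0; apply: IH => // a.
pose up x : atom T := [ffun u => if u == t then x else a u].
have lits_up x : lits (up x) ts = lits a ts.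
  elim: ts tts {uts b0} => //= u ts IH; rewrite inE negb_or.
  case/andP=> neq_tu /IH ->; congr BAnd.
  by rewrite /literal ffunE eq_sym (negbTE neq_tu).
apply: (@ba_split _ (BPrim t)).
  by have := b0 (up true); rewrite lits_up /literal ffunE eqxx -ba_andA.
by have := b0 (up false); rewrite lits_up /literal ffunE eqxx -ba_andA.
Qed.

Theorem atomP b :
  ba_minimal_nonzero b <-> exists! a : atom T, b ≡BA atom_bexp a.
Proof.
split=> [[nz_b min_b]|[a [eq_ba _]]].
  have [a ba] : exists a : atom T, beval a b.
    apply/existsP; apply: contra_notT nz_b; rewrite negb_exists => /forallP b0.
    by apply: beval_complete0 => a; apply/negbTE.
  have ab : BAnd (atom_bexp a) b ≡BA atom_bexp a by rewrite atom_and ba.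
  have eq_ba : b ≡BA atom_bexp a.
    case: (min_b _ (ba_and_le ab)) => [/(beval_sound a)|/ba_sym //].
    by rewrite beval_atom eqxx.
  exists a; split=> // a' eq_ba'; apply/eqP.
  by rewrite -beval_atom -(beval_sound a eq_ba').
split=> [|c le_cb].
  by rewrite eq_ba => /(beval_sound a); rewrite beval_atom eqxx.
have := atom_and a c; case: (beval a c); rewrite -eq_ba (ba_le_and le_cb).
  by right.
by left.
Qed.

End Atoms.

(* Main.v *)
(** Two expressions are equivalent as soon as they are equivalent after every
    atom, so all equations can be checked one atom at a time.  If [sX] and [sY]
    solve [X] and [Y], put [l := e ^[b] ⋅ e], where [e] is the sum of the
    outcomes of [h], continued with [sX] or [sY], and [b] holds at the atoms at
    which [h] moves into [X].  Unrolling the loop shows that [l] behaves as [h]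
    with every continuation [sX x] followed by [l], so [x |-> sX x ⋅ l] on [X]
    together with [sY] on [Y] solves the uniform continuation. *)
Require Import Defs.
From mathcomp Require Import all_boot.
From Stdlib Require Import Setoid Morphisms.

Set Implicit Arguments.
Unset Strict Implicit.
Unset Printing Implicit Defensive.

#[local] Hint Resolve ba_refl gkat_refl : core.

#[export] Instance gkat_eq_equiv (Sigma T : Type) :
  Equivalence (@gkat_eq Sigma T).
Proof. by split; [exact: gkat_refl | exact: gkat_sym | exact: gkat_trans]. Qed.

#[export] Instance ESeq_proper (Sigma T : Type) :
  Proper (@gkat_eq Sigma T ==> @gkat_eq Sigma T ==> @gkat_eq Sigma T)
    (@ESeq Sigma T).
Proof. by move=> e e' He f f' Hf; apply: gkat_seq_congr. Qed.

#[export] Instance EIf_proper (Sigma T : Type) :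
  Proper (@ba_eq T ==> @gkat_eq Sigma T ==> @gkat_eq Sigma T ==>
          @gkat_eq Sigma T) (@EIf Sigma T).
Proof.
by move=> b b' Hb e e' He f f' Hf; apply: gkat_if_congr => //; apply: gkat_ba.
Qed.

#[export] Instance ETest_proper (Sigma T : Type) :
  Proper (@ba_eq T ==> @gkat_eq Sigma T) (@ETest Sigma T).
Proof. by move=> b b' Hb; apply: gkat_ba. Qed.

(** Both differences [BAnd b (BNeg c)] and [BAnd c (BNeg b)] are false at every atom, hence zero, so
    each side equals the meet of the two. *)
Lemma ba_eq_complete (T : finType) (b c : bexp T) :
  (forall a : atom T, beval a b = beval a c) -> b ≡BA c.
Proof.
move=> eq_bc.
have bNc : BAnd b (BNeg c) ≡BA BZero.
  by apply: beval_complete0 => a /=; rewrite eq_bc andbN.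
have cNb : BAnd c (BNeg b) ≡BA BZero.
  by apply: beval_complete0 => a /=; rewrite eq_bc andbN.
have -> : b ≡BA BAnd b c.
  by rewrite -{1}[b]ba_and1 -(ba_orN c) ba_and_orr bNc ba_or0.
by rewrite -{2}[c]ba_and1 -(ba_orN b) ba_and_orr cNb ba_or0; apply: ba_andC.
Qed.

Section Guards.
Variables (Sigma : Type) (T : finType).
Implicit Types (b c d : bexp T) (e f g : exp Sigma T) (a : atom T).

Lemma if_neg b e f : e +_[b] f ≡ e +_[b] (ETest (BNeg b) ⋅ f).
Proof. by rewrite gkat_U2 gkat_U4 -gkat_U2. Qed.

Lemma if_zero b e : e +_[b] ETest BZero ≡ ETest b ⋅ e.
Proof.
have test_if : @ETest Sigma T b ≡ ETest BOne +_[b] ETest BZero.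
  (* U1 doubles the test. U4 then strips it from the left branch, leaving [BOne]; in the right
     branch it meets [BNeg b] and vanishes. *)
  rewrite -{1}[ETest b](gkat_U1 b) -{1}[ETest b](gkat_S5) -gkat_U4.
  by rewrite if_neg gkat_test_and (ba_andC _ b) ba_andN.
by rewrite test_if -gkat_U5 gkat_S4 gkat_S2.
Qed.

Lemma if_false e f : e +_[BZero] f ≡ f.
Proof.
rewrite gkat_U2 if_neg.
have -> : BNeg (BNeg BZero) ≡BA (BZero : bexp T) by apply: ba_eq_complete.
rewrite gkat_S2 if_zero.
have -> : BNeg BZero ≡BA (BOne : bexp T) by apply: ba_eq_complete.
exact: gkat_S4.
Qed.

Lemma test_if d b e f :
  ETest d ⋅ (e +_[b] f) ≡ e +_[BAnd b d] (ETest d ⋅ f).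
Proof. by rewrite -if_zero gkat_U3 if_zero. Qed.

(** After U3 the else branches are compared under [BNeg b], where the guards [BOr b c] and [c]
    agree. *)
Lemma if_assoc b c e f g :
  e +_[b] (f +_[c] g) ≡ (e +_[b] f) +_[BOr b c] g.
Proof.
rewrite gkat_U3 ba_absorb if_neg [X in _ ≡ X]if_neg !test_if.
suff -> : BAnd (BOr b c) (BNeg b) ≡BA BAnd c (BNeg b) by [].
by apply: ba_eq_complete => a /=; case: (beval a b) => //=; rewrite !andbF.
Qed.

Lemma test_and_seq b c e :
  ETest b ⋅ (ETest c ⋅ e) ≡ ETest (BAnd b c) ⋅ e.
Proof. by rewrite -gkat_S1 gkat_test_and. Qed.

(** An atom decides every guard: its meet with [b] is the atom itself or zero. *)
Lemma atom_if a b e f :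
  ETest (atom_bexp a) ⋅ (e +_[b] f) ≡
  ETest (atom_bexp a) ⋅ (if beval a b then e else f).
Proof.
rewrite test_if ba_andC atom_and; case: (beval a b); last exact: if_false.
rewrite if_neg test_and_seq ba_andC ba_andN gkat_S2.
exact: if_zero.
Qed.

Lemma foldr_if_const (s : seq (atom T)) e :
  foldr (fun a f => e +_[atom_bexp a] f) (ETest BZero) s ≡
  ETest (foldr (fun a b => BOr (atom_bexp a) b) BZero s) ⋅ e.
Proof.
elim: s => /= [|a s IH]; first by rewrite gkat_S2.
by rewrite IH -if_zero if_assoc gkat_U1 if_zero.
Qed.

Lemma beval_foldr_atom (s : seq (atom T)) a :
  beval a (foldr (fun a' b => BOr (atom_bexp a') b) BZero s) = (a \in s).
Proof. by elim: s => //= a' s ->; rewrite beval_atom inE. Qed.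

(** The atoms join to one, so an expression is the guarded sum over all atoms of itself; U4 lets
    each summand be replaced behind its own atom. *)
Lemma gkat_eq_atomwise e f :
  (forall a, ETest (atom_bexp a) ⋅ e ≡ ETest (atom_bexp a) ⋅ f) -> e ≡ f.
Proof.
move=> eq_ef.
have split_atoms g : g ≡
    foldr (fun a f => g +_[atom_bexp a] f) (ETest BZero) (enum (atom T)).
  rewrite foldr_if_const -{1}[g]gkat_S4.
  suff -> : foldr (fun a b => BOr (atom_bexp a) b) BZero (enum (atom T))
    ≡BA BOne by [].
  by apply: ba_eq_complete => a; rewrite beval_foldr_atom mem_enum.
rewrite (split_atoms e) (split_atoms f).
elim: (enum _) => //= a s ->.
by rewrite gkat_U4 eq_ef -gkat_U4.
Qed.

Lemma atom_gsum (Phi : {set atom T}) (F : atom T -> exp Sigma T) a :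
  a \in Phi ->
  ETest (atom_bexp a) ⋅ gsum Phi F ≡ ETest (atom_bexp a) ⋅ F a.
Proof.
rewrite /gsum -mem_enum; elim: (enum Phi) => //= a' s IH.
by rewrite inE atom_if beval_atom; case: eqP => [-> //|_ /IH].
Qed.

Lemma atom_while a b e f :
  ETest (atom_bexp a) ⋅ (e ^[b] ⋅ f) ≡
  ETest (atom_bexp a) ⋅ (if beval a b then e ⋅ (e ^[b] ⋅ f) else f).
Proof.
rewrite {1}gkat_W1 -gkat_U5 atom_if; case: (beval a b).
  by rewrite gkat_S1.
by rewrite gkat_S4.
Qed.

End Guards.

Lemma is_solution_atomwise (Sigma : Type) (T : finType)
    (X : coalgebra Sigma T) (s : X -> exp Sigma T) :
  is_solution s <-> forall (x : X) (a : atom T),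
    ETest (atom_bexp a) ⋅ s x ≡
    ETest (atom_bexp a) ⋅ outcome_exp s (delta x a).
Proof.
split=> [sol x a|sol x].
  by rewrite sol atom_gsum ?inE.
by apply: gkat_eq_atomwise => a; rewrite sol atom_gsum ?inE.
Qed.

Lemma outcome_exp_map (Sigma T X Y : Type) (f : X -> Y) (s : Y -> exp Sigma T)
    (o : bool + Sigma * X) :
  outcome_exp s (map_outcome f o) = outcome_exp (s \o f) o.
Proof. by case: o => [|[]]. Qed.

Section Step.
Variables (Sigma : Type) (T : finType) (X Y : coalgebra Sigma T).
Variable h : G Sigma T (coproduct X Y).
Variables (sX : X -> exp Sigma T) (sY : Y -> exp Sigma T).

Definition moves_left (a : atom T) : bool :=
  if h a is inr (_, inl _) then true else false.

Definition loop_guard : bexp T :=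
  foldr (fun a b => BOr (atom_bexp a) b) BZero
    (filter moves_left (enum (atom T))).

Definition side_sol (z : coproduct X Y) : exp Sigma T :=
  match z with inl x => sX x | inr y => sY y end.

Definition branches : exp Sigma T :=
  gsum [set: atom T] (fun a => outcome_exp side_sol (h a)).

(** The same sum serves as loop body and as exit: the loop guard selects the
    relevant atoms. *)
Definition continuation : exp Sigma T := branches ^[loop_guard] ⋅ branches.

Definition step_sol (z : coproduct X Y) : exp Sigma T :=
  match z with inl x => sX x ⋅ continuation | inr y => sY y end.

(** If [h a] moves into [X], the guard holds and one unrolling performs that move, then
    [continuation] again. Otherwise the loop exits into [branches], and there [side_sol] and
    [step_sol] give the same outcome. *)
Lemma atom_continuation (a : atom T) :
  ETest (atom_bexp a) ⋅ continuation ≡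
  ETest (atom_bexp a) ⋅ outcome_exp step_sol (h a).
Proof.
rewrite /continuation atom_while beval_foldr_atom mem_filter mem_enum andbT.
rewrite -/continuation /moves_left.
have := @atom_gsum Sigma T setT (fun a => outcome_exp side_sol (h a)) a.
rewrite -/branches inE => /(_ isT).
case: (h a) => [r|[p [x|y]]] //= eq_br.
by rewrite -gkat_S1 eq_br !gkat_S1.
Qed.

Lemma step_sol_is_solution :
  is_solution sX -> is_solution sY ->
  @is_solution Sigma T
    (@uniform_continuation Sigma T (coproduct X Y) (@in_left X Y) h) step_sol.
Proof.
move=> /is_solution_atomwise solX /is_solution_atomwise solY.
apply/is_solution_atomwise => -[x|y] a /=.
  rewrite -gkat_S1 solX gkat_S1.
  case: (delta x a) => [[]|[p x']] /=.
  (* Acceptance in [X] is where the uniform continuation substitutes [h a]. *)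
  - by rewrite gkat_S4 atom_continuation.
  - by rewrite gkat_S2.
  - by rewrite gkat_S1.
by rewrite solY; case: (delta y a) => [[]|[p y']].
Qed.

End Step.

Theorem theorem4p7 (Sigma : Type) (T : finType)
    (Sigma_nonempty : inhabited Sigma) (T_nonempty : (0 < #|T|)%N)
    (X : coalgebra Sigma T) :
  well_nested X -> exists s : X -> exp Sigma T, is_solution s.
Proof.
elim=> {X} [X no_trans|X Y h _ [sX solX] _ [sY solY]].
  (* Without transitions no outcome consults the solution, so the constant zero map is a mere
     placeholder. *)
  exists (fun x => gsum [set: atom T]
            (fun a => outcome_exp (fun=> ETest BZero) (delta x a))).
  apply/is_solution_atomwise => x a; rewrite atom_gsum ?inE //.
  by have [r ->] := no_trans x a.
by exists (step_sol h sX sY); apply: step_sol_is_solution.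
Qed.
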